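(* The AC Optimal Power Flow problem for 1-line networks, i.e. the two-variable problem (P) in $(w^R,w^I)\in\mathbb{R}^2$ defined in the context, is boundary-invex.
   Context: Problem (P). Parameters: line admittance $g+\mathbf{i}b$; $w=|V_1|^2$, the (fixed) squared voltage magnitude at bus 1; cost coefficients $c_1,c_2$; thermal limit $s^u$; real bounds $(p_k^g)^l,(p_k^g)^u,(q_k^g)^l,(q_k^g)^u$ and real demands $p_k^d,q_k^d$ ($k=1,2$); voltage bounds $v^l_2,v^u_2$; angle bounds $\theta^l,\theta^u$. Assumptions on bounds: $-\pi/6\le\theta^l<\theta^u\le\pi/6$; all voltage magnitude bounds satisfy $0.95\le v_k^l<v_k^u\le 1.05$ for $k=1,2$, so in particular $0.95^2\le w\le 1.05^2$. Sign conventions: $g>0$, $b<0$, $c_1,c_2\ge 0$, $s^u>0$. Put $p_{12}=gw-gw^R-bw^I$, $\;q_{12}=-bw+bw^R-gw^I$, $\;p_{21}=\frac{g}{w}((w^R)^2+(w^I)^2)-gw^R+bw^I$, $\;q_{21}=-\frac{b}{w}((w^R)^2+(w^I)^2)+bw^R+gw^I$. (P): minimize $c_1p_{12}+c_2p_{21}$ subject to $p_{12}^2+q_{12}^2\le s^u$; $\;p_{21}^2+q_{21}^2\le s^u$; $(p_1^g)^l-p_1^d\le p_{12}\le (p_1^g)^u-p_1^d$; $\;(q_1^g)^l-q_1^d\le q_{12}\le (q_1^g)^u-q_1^d$; $(p_2^g)^l-p_2^d\le p_{21}\le (p_2^g)^u-p_2^d$; $\;(q_2^g)^l-q_2^d\le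 q_{21}\le (q_2^g)^u-q_2^d$; $(v_2^l)^2\le \frac{(w^R)^2+(w^I)^2}{w}\le (v_2^u)^2$; $\;w^R\tan\theta^l\le w^I\le w^R\tan\theta^u$. Boundary-invexity. Write (P) as: maximize $f=-(c_1p_{12}+c_2p_{21})$ subject to constraints $g_i\le 0$ (one per inequality above), with feasible set $F$. For each non-convex constraint ($g_i$ not a convex function) let (NLP$_{2i}$) be: minimize $f$ subject to $g_i\ge 0$. Its KKT points are the points $\vec x^*$ with $g_i(\vec x^* )\ge 0$ for which there is $\mu\ge 0$ with $\nabla f(\vec x^* )=\mu\nabla g_i(\vec x^* )$ and $\mu g_i(\vec x^* )=0$. The KKT multiplier of $\vec x^*$ in the equality-constrained problem (NLP$_i$) (minimize $f$ subject to $g_i=0$) is the real $\lambda$ with $\nabla f(\vec x^* )=-\lambda\nabla g_i(\vec x^* )$. The problem is boundary-invex if for each non-convex constraint and every KKT point $\vec x^*$ of (NLP$_{2i}$) at least one of the following holds: (1) $\vec x^*\notin F$; (2) $\vec x^*$ has a non-negative KKT multiplier in (NLP$_i$); (3) $\vec x^*$ is a local maximizer of $f$ on $F$. *)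

(* Defs.v *)
From Stdlib Require Import Reals.
From Coquelicot Require Import Coquelicot.
Open Scope R_scope.

(** The problem considered throughout is:
    maximize [f] subject to [g i <= 0] for every [i : I]. *)

(** [Derive] is total, so [grad] is the gradient only where the partial
    derivatives exist; it is used below on polynomial functions only. *)
Definition grad (f : R * R -> R) (x : R * R) : R * R :=
  (Derive (fun s => f (s, snd x)) (fst x), Derive (fun t => f (fst x, t)) (snd x)).

Definition convex_fun (h : R * R -> R) : Prop :=
  forall (x y : R * R) (t : R), 0 <= t <= 1 ->
    h (plus (scal t x) (scal (1 - t) y)) <= t * h x + (1 - t) * h y.

Definition feasible {I : Type} (g : I -> R * R -> R) (x : R * R) : Prop :=
  forall i : I, g i x <= 0.

(** KKT points of: minimize [f] subject to [gi >= 0]. *)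
Definition is_KKT_point_ge (f gi : R * R -> R) (x : R * R) : Prop :=
  0 <= gi x /\
  exists mu : R, 0 <= mu /\ grad f x = scal mu (grad gi x) /\ mu * gi x = 0.

(** KKT multipliers at [x] of: minimize [f] subject to [gi = 0]. *)
Definition is_KKT_multiplier_eq (f gi : R * R -> R) (x : R * R) (lambda : R) : Prop :=
  grad f x = scal (- lambda) (grad gi x).

Definition is_local_maximizer (f : R * R -> R) (F : R * R -> Prop) (x : R * R) : Prop :=
  F x /\ locally x (fun y => F y -> f y <= f x).

Definition boundary_invex {I : Type} (f : R * R -> R) (g : I -> R * R -> R) : Prop :=
  forall i : I, ~ convex_fun (g i) ->
  forall x : R * R, is_KKT_point_ge f (g i) x ->
    ~ feasible g x \/
    (exists lambda : R, 0 <= lambda /\ is_KKT_multiplier_eq f (g i) x lambda) \/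
    is_local_maximizer f (feasible g) x.

Record network : Type := Network {
  g : R; b : R;                                  (* line admittance g + i b *)
  w : R;                                         (* squared voltage magnitude at bus 1 *)
  c1 : R; c2 : R;
  su : R;                                        (* bounds the squared apparent power *)
  pg1l : R; pg1u : R; qg1l : R; qg1u : R; pd1 : R; qd1 : R;
  pg2l : R; pg2u : R; qg2l : R; qg2u : R; pd2 : R; qd2 : R;
  v1l : R; v1u : R; v2l : R; v2u : R;
  thl : R; thu : R
}.

Definition standing_assumptions (N : network) : Prop :=
  0 < g N /\ b N < 0 /\ 0 <= c1 N /\ 0 <= c2 N /\ 0 < su N /\
  0.95 <= v1l N /\ v1l N < v1u N /\ v1u N <= 1.05 /\
  0.95 <= v2l N /\ v2l N < v2u N /\ v2u N <= 1.05 /\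
  v1l N ^ 2 <= w N <= v1u N ^ 2 /\
  - PI / 6 <= thl N /\ thl N < thu N /\ thu N <= PI / 6.

(** A point of [R * R] is the pair [(wR, wI)]. *)
Definition p12 (N : network) (x : R * R) : R :=
  let (wR, wI) := x in g N * w N - g N * wR - b N * wI.

Definition q12 (N : network) (x : R * R) : R :=
  let (wR, wI) := x in - b N * w N + b N * wR - g N * wI.

Definition p21 (N : network) (x : R * R) : R :=
  let (wR, wI) := x in g N / w N * (wR ^ 2 + wI ^ 2) - g N * wR + b N * wI.

Definition q21 (N : network) (x : R * R) : R :=
  let (wR, wI) := x in - (b N / w N) * (wR ^ 2 + wI ^ 2) + b N * wR + g N * wI.

Definition opf_objective (N : network) (x : R * R) : R :=
  - (c1 N * p12 N x + c2 N * p21 N x).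

Inductive opf_index : Type :=
  | thermal12 | thermal21
  | p12_lower | p12_upper | q12_lower | q12_upper
  | p21_lower | p21_upper | q21_lower | q21_upper
  | voltage_lower | voltage_upper
  | angle_lower | angle_upper.

Definition opf_constraint (N : network) (i : opf_index) (x : R * R) : R :=
  let (wR, wI) := x in
  match i with
  | thermal12 => p12 N x ^ 2 + q12 N x ^ 2 - su N
  | thermal21 => p21 N x ^ 2 + q21 N x ^ 2 - su N
  | p12_lower => (pg1l N - pd1 N) - p12 N x
  | p12_upper => p12 N x - (pg1u N - pd1 N)
  | q12_lower => (qg1l N - qd1 N) - q12 N x
  | q12_upper => q12 N x - (qg1u N - qd1 N)
  | p21_lower => (pg2l N - pd2 N) - p21 N x
  | p21_upper => p21 N x - (pg2u N - pd2 N)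
  | q21_lower => (qg2l N - qd2 N) - q21 N x
  | q21_upper => q21 N x - (qg2u N - qd2 N)
  | voltage_lower => v2l N ^ 2 - (wR ^ 2 + wI ^ 2) / w N
  | voltage_upper => (wR ^ 2 + wI ^ 2) / w N - v2u N ^ 2
  | angle_lower => wR * tan (thl N) - wI
  | angle_upper => wI - wR * tan (thu N)
  end.

(* Main.v *)
Require Import Defs.
From Stdlib Require Import Reals Lra Psatz Classical.
From Coquelicot Require Import Coquelicot.
Open Scope R_scope.

(** At a feasible KKT point [x] of (NLP_2i), [grad f = mu * grad g_i], so the
    Lagrangian [f - mu * g_i] is critical at [x], dominates [f] on the feasible
    set, and equals [f] at [x].  It therefore suffices that it has a local
    maximum at [x], and condition (3) then always holds.

    Every constraint except [thermal21] has the shape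
    [a * (wR^2 + wI^2) + l * wR + m * wI + n], as does the objective, so the
    Lagrangian is a quadratic with Hessian [2A * Id].  If [A > 0], criticality
    forces [wR <= w / 2], against the angle and voltage bounds.

    For [thermal21], with [z = wR + i wI], the constraint is
    [K |z (z - w)|^2 - su], which is strictly convex near [z] as soon as
    [|2z - w|^2 > 2 |z (z - w)|]; this holds when [3 |z|^2 > 2 w^2]. *)

(** * Quadratics whose Hessian is a multiple of the identity *)

Definition isoquad (a l m n : R) (x : R * R) : R :=
  a * (fst x ^ 2 + snd x ^ 2) + l * fst x + m * snd x + n.

Lemma grad_ext (f h : R * R -> R) (x : R * R) :
  (forall y, f y = h y) -> grad f x = grad h x.
Proof.
intros E; unfold grad; f_equal; apply Derive_ext; intros t; apply E.
Qed.

Lemma grad_isoquad (a l m n : R) (x : R * R) :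
  grad (isoquad a l m n) x = (2 * a * fst x + l, 2 * a * snd x + m).
Proof.
unfold grad, isoquad; simpl.
f_equal; apply is_derive_unique; auto_derive; trivial; ring.
Qed.

Lemma isoquad_expansion (a l m n : R) (x y : R * R) :
  isoquad a l m n y = isoquad a l m n x
    + (2 * a * fst x + l) * (fst y - fst x) + (2 * a * snd x + m) * (snd y - snd x)
    + a * ((fst y - fst x) ^ 2 + (snd y - snd x) ^ 2).
Proof. unfold isoquad; ring. Qed.

Lemma is_KKT_point_ge_ext (f f' h h' : R * R -> R) (x : R * R) :
  (forall y, f y = f' y) -> (forall y, h y = h' y) ->
  is_KKT_point_ge f h x -> is_KKT_point_ge f' h' x.
Proof.
intros Ef Eh (H0 & mu & Hmu & Hg & Hc).
rewrite (grad_ext _ _ _ Ef), (grad_ext _ _ _ Eh) in Hg.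
rewrite Eh in H0, Hc.
split; [exact H0 | exists mu; auto].
Qed.

(** [l + w * a] is the [wR]-derivative of the constraint on the line [wR = w / 2], and [fl + w * fa]
    that of the objective. If [l + w * a <= 0], the Lagrangian has a non-negative [wR]-derivative
    there; a positive leading coefficient would make it positive at [x], against criticality. *)
Lemma local_maximizer_isoquad (fa fl fm fn a l m n w : R) (F : R * R -> Prop)
  (x : R * R) :
  F x -> (forall y, F y -> isoquad a l m n y <= 0) ->
  is_KKT_point_ge (isoquad fa fl fm fn) (isoquad a l m n) x ->
  fa <= 0 -> 0 <= fl + w * fa -> w < 2 * fst x -> (0 <= a \/ l + w * a <= 0) ->
  is_local_maximizer (isoquad fa fl fm fn) F x.
Proof.
intros Fx HF (H0 & mu & Hmu & Hg & Hc) Hfa Hfl Hx Ha.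
rewrite !grad_isoquad in Hg.
injection Hg as H1 H2.
change (2 * fa * fst x + fl = mu * (2 * a * fst x + l)) in H1.
change (2 * fa * snd x + fm = mu * (2 * a * snd x + m)) in H2.
assert (HA : fa - mu * a <= 0).
{ destruct Ha as [Ha | Ha]; [nra |].
  destruct (Rle_lt_dec (fa - mu * a) 0) as [|Hpos]; trivial.
  assert (w * (fa - mu * a) < 2 * fst x * (fa - mu * a)) by nra.
  assert (2 * fst x * (fa - mu * a) = mu * l - fl) by nra.
  assert (mu * (l + w * a) <= 0) by nra.
  nra. }
split; [exact Fx |].
enough (HL : forall y, F y -> isoquad fa fl fm fn y <= isoquad fa fl fm fn x)
  by (apply filter_forall; exact HL).
intros y Fy.
rewrite (isoquad_expansion fa fl fm fn x y), H1, H2.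
pose proof (isoquad_expansion a l m n x y) as E.
pose proof (HF y Fy) as Hy.
set (D := (fst y - fst x) ^ 2 + (snd y - snd x) ^ 2) in E |- *.
assert (HD : 0 <= D) by (apply Rplus_le_le_0_compat; apply pow2_ge_0).
assert ((fa - mu * a) * D <= 0) by nra.
assert (Hmy : mu * isoquad a l m n y <= 0) by nra.
rewrite E in Hmy.
lra.
Qed.

(** * The quartic thermal limit at bus 2 *)

(* With [z = wR + i wI], this is [K * |z (z - w)|^2 - s]. *)
Definition thermal (K w s : R) (x : R * R) : R :=
  K * ((fst x ^ 2 + snd x ^ 2) * ((fst x - w) ^ 2 + snd x ^ 2)) - s.

Definition thermal_dR (K w : R) (x : R * R) : R :=
  K * (2 * fst x * ((fst x - w) ^ 2 + snd x ^ 2)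
       + (fst x ^ 2 + snd x ^ 2) * (2 * (fst x - w))).

Definition thermal_dI (K w : R) (x : R * R) : R :=
  K * (2 * snd x * ((fst x - w) ^ 2 + snd x ^ 2)
       + (fst x ^ 2 + snd x ^ 2) * (2 * snd x)).

Lemma grad_thermal (K w s : R) (x : R * R) :
  grad (thermal K w s) x = (thermal_dR K w x, thermal_dI K w x).
Proof.
unfold grad, thermal, thermal_dR, thermal_dI; simpl.
f_equal; apply is_derive_unique; auto_derive; trivial; ring.
Qed.

(* With [p(z) = z^2 - w z] and [y = z + d], this reads [4 |p(z)|^2 < |p'(z) + d|^4]. *)
Lemma thermal_curvature (w : R) (x : R * R) :
  2 * w ^ 2 < 3 * (fst x ^ 2 + snd x ^ 2) ->
  locally x (fun y : R * R =>
    4 * ((fst x ^ 2 + snd x ^ 2) * ((fst x - w) ^ 2 + snd x ^ 2)) <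
    ((fst x + fst y - w) ^ 2 + (snd x + snd y) ^ 2) ^ 2).
Proof.
intros H.
set (c := 4 * _).
set (F := fun y : R * R => ((fst x + fst y - w) ^ 2 + (snd x + snd y) ^ 2) ^ 2).
assert (CF : continuous F x).
{ set (u := fun y : R * R => plus (fst y) (fst x - w)).
  set (v := fun y : R * R => plus (snd y) (snd x)).
  set (G := fun y => plus (mult (u y) (u y)) (mult (v y) (v y))).
  apply continuous_ext with (fun y => mult (G y) (G y)).
  { intros y; unfold F, G, u, v, plus, mult; simpl; unfold mult; simpl; ring. }
  assert (Cu : continuous u x)
    by (apply (continuous_plus (V := R_NormedModule));
        [destruct x; apply continuous_fst | apply continuous_const]).
  assert (Cv : continuous v x)
    by (apply (continuous_plus (V := R_NormedModule));
        [destruct x; apply continuous_snd | apply continuous_const]).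
  assert (CG : continuous G x)
    by (apply (continuous_plus (V := R_NormedModule));
        apply (continuous_mult (K := R_AbsRing)); assumption).
  apply (continuous_mult (K := R_AbsRing)); exact CG. }
apply (CF (fun v => c < v)), (open_gt c).
unfold F, c.
set (r := fst x ^ 2 + snd x ^ 2) in *.
assert (Hr : 0 < r) by (pose proof (pow2_ge_0 w); lra).
(* The gap at [y = x], as a square plus a term that the hypothesis makes positive. *)
assert (E : ((fst x + fst x - w) ^ 2 + (snd x + snd x) ^ 2) ^ 2
  - 4 * (r * ((fst x - w) ^ 2 + snd x ^ 2))
  = (3 * r - 4 * fst x * w + w ^ 2) ^ 2 + r * (3 * r - 2 * w ^ 2))
  by (unfold r; ring).
assert (0 < r * (3 * r - 2 * w ^ 2)) by (apply Rmult_lt_0_compat; lra).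
pose proof (pow2_ge_0 (3 * r - 4 * fst x * w + w ^ 2)).
lra.
Qed.

(** The remainder beyond the tangent plane is [K * (|d + i e|^2 * T + 2 * X)]. Cauchy-Schwarz bounds
    [|X|] by [|z (z - w)| |d + i e|^2], and the hypothesis says [2 |z (z - w)| < T]. *)
Lemma thermal_support (K w s : R) (x y : R * R) : 0 <= K ->
  4 * ((fst x ^ 2 + snd x ^ 2) * ((fst x - w) ^ 2 + snd x ^ 2)) <
    ((fst x + fst y - w) ^ 2 + (snd x + snd y) ^ 2) ^ 2 ->
  thermal K w s x + thermal_dR K w x * (fst y - fst x)
    + thermal_dI K w x * (snd y - snd x) <= thermal K w s y.
Proof.
destruct x as [p q], y as [p' q']; unfold thermal, thermal_dR, thermal_dI; simpl fst; simpl snd.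
intros HK H.
set (d := p' - p); set (e := q' - q).
(* [P + i Q] is [z^2 - w z] at [z = p + i q]; [X] below is the real part of
   [conj (P + i Q) (d + i e)^2]. *)
set (P := p ^ 2 - q ^ 2 - w * p); set (Q := 2 * p * q - w * q).
set (T := (p + p' - w) ^ 2 + (q + q') ^ 2) in *.
set (X := P * (d ^ 2 - e ^ 2) + 2 * Q * d * e).
assert (E1 : (p ^ 2 + q ^ 2) * ((p - w) ^ 2 + q ^ 2) = P ^ 2 + Q ^ 2)
  by (unfold P, Q; ring).
assert (HT : 0 <= T) by (apply Rplus_le_le_0_compat; apply pow2_ge_0).
assert (HX : X ^ 2 <= (P ^ 2 + Q ^ 2) * (d ^ 2 + e ^ 2) ^ 2).
(* The square of the imaginary part of the same product. *)
{ assert (0 <= (P * (2 * d * e) - Q * (d ^ 2 - e ^ 2)) ^ 2) by apply pow2_ge_0.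
  unfold X; nra. }
assert (HD : 0 <= d ^ 2 + e ^ 2) by (apply Rplus_le_le_0_compat; apply pow2_ge_0).
assert (HDT : 0 <= (d ^ 2 + e ^ 2) * T) by (apply Rmult_le_pos; assumption).
assert (Hmain : 0 <= (d ^ 2 + e ^ 2) * T + 2 * X).
{ rewrite E1 in H.
  assert ((2 * X) ^ 2 <= ((d ^ 2 + e ^ 2) * T) ^ 2).
  { assert (4 * (P ^ 2 + Q ^ 2) * (d ^ 2 + e ^ 2) ^ 2 <= T ^ 2 * (d ^ 2 + e ^ 2) ^ 2)
      by (apply Rmult_le_compat_r; [apply pow2_ge_0 | lra]).
    nra. }
  nra. }
(* [|p(z+d)|^2 - |p(z)|^2 - 2 Re (conj (p(z)) p'(z) d)
    = |d|^2 |p'(z) + d|^2 + 2 Re (conj (p(z)) d^2)] *)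
assert (E2 : (p' ^ 2 + q' ^ 2) * ((p' - w) ^ 2 + q' ^ 2)
  = (p ^ 2 + q ^ 2) * ((p - w) ^ 2 + q ^ 2)
    + (2 * p * ((p - w) ^ 2 + q ^ 2) + (p ^ 2 + q ^ 2) * (2 * (p - w))) * d
    + (2 * q * ((p - w) ^ 2 + q ^ 2) + (p ^ 2 + q ^ 2) * (2 * q)) * e
    + ((d ^ 2 + e ^ 2) * T + 2 * X))
  by (unfold X, T, P, Q, d, e; ring).
rewrite E2.
assert (0 <= K * ((d ^ 2 + e ^ 2) * T + 2 * X)) by nra.
nra.
Qed.

Lemma local_maximizer_thermal (fa fl fm fn K w s : R) (F : R * R -> Prop)
  (x : R * R) :
  F x -> (forall y, F y -> thermal K w s y <= 0) ->
  is_KKT_point_ge (isoquad fa fl fm fn) (thermal K w s) x ->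
  fa <= 0 -> 0 <= K -> 2 * w ^ 2 < 3 * (fst x ^ 2 + snd x ^ 2) ->
  is_local_maximizer (isoquad fa fl fm fn) F x.
Proof.
intros Fx HF (H0 & mu & Hmu & Hg & Hc) Hfa HK Hx.
rewrite grad_isoquad, grad_thermal in Hg.
injection Hg as H1 H2.
change (2 * fa * fst x + fl = mu * thermal_dR K w x) in H1.
change (2 * fa * snd x + fm = mu * thermal_dI K w x) in H2.
split; [exact Fx |].
refine (filter_imp _ _ _ (thermal_curvature w x Hx)).
revert x Fx H0 Hc Hx H1 H2; intros [p q] Fx H0 Hc Hx H1 H2 [p' q'] Hy Fy.
apply (thermal_support K w s _ _ HK) in Hy.
specialize (HF _ Fy).
simpl fst in Hy; simpl snd in Hy.
rewrite (isoquad_expansion fa fl fm fn (p, q) (p', q')), H1, H2.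
assert (0 <= (p' - p) ^ 2 + (q' - q) ^ 2)
  by (apply Rplus_le_le_0_compat; apply pow2_ge_0).
assert (fa * ((p' - p) ^ 2 + (q' - q) ^ 2) <= 0) by nra.
(* As [mu * thermal K w s (p, q) = 0], this makes the linear term of the objective non-positive. *)
assert (mu * (thermal K w s (p, q) + thermal_dR K w (p, q) * (p' - p)
              + thermal_dI K w (p, q) * (q' - q)) <= 0) by nra.
simpl fst; simpl snd; lra.
Qed.

(** * Location of the feasible set *)

Lemma tan_bound (t : R) : - PI / 6 <= t <= PI / 6 -> -1 < tan t < 1.
Proof.
intros H; pose proof PI_RGT_0.
replace (-1) with (tan (- (PI / 4))) by (rewrite tan_neg, tan_PI4; ring).
rewrite <- tan_PI4.
split; apply tan_increasing; lra.
Qed.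

Lemma w_bounds (N : network) (hN : standing_assumptions N) : 0.95 ^ 2 <= w N <= 1.05 ^ 2.
Proof. unfold standing_assumptions in hN; nra. Qed.

Lemma feasible_modulus (N : network) (hN : standing_assumptions N)
  (x : R * R) : feasible (opf_constraint N) x ->
  0.95 ^ 2 * w N <= fst x ^ 2 + snd x ^ 2.
Proof.
intros Fx; pose proof (w_bounds N hN) as Hw.
pose proof (Fx voltage_lower) as H.
destruct x as [p q]; simpl fst; simpl snd; unfold opf_constraint in H.
assert (0.95 ^ 2 <= v2l N ^ 2) by (unfold standing_assumptions in hN; nra).
assert (E : p ^ 2 + q ^ 2 = (p ^ 2 + q ^ 2) / w N * w N) by (field; lra).
rewrite E; apply Rmult_le_compat_r; lra.
Qed.

Lemma feasible_wR (N : network) (hN : standing_assumptions N)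
  (x : R * R) : feasible (opf_constraint N) x -> w N < 2 * fst x.
Proof.
intros Fx; pose proof (w_bounds N hN) as Hw; pose proof (feasible_modulus N hN x Fx) as Hr.
pose proof (Fx angle_lower) as Hl; pose proof (Fx angle_upper) as Hu.
destruct x as [p q]; simpl fst in *; simpl snd in *; unfold opf_constraint in Hl, Hu.
assert (Ht : -1 < tan (thl N) /\ tan (thl N) < tan (thu N) /\ tan (thu N) < 1).
{ unfold standing_assumptions in hN; pose proof PI_RGT_0.
  repeat split; [apply tan_bound | apply tan_increasing | apply tan_bound]; lra. }
(* The angle constraints give [p * tan thl <= q <= p * tan thu] with [tan thl < tan thu]. *)
assert (0 <= p) by nra.
assert (q <= p /\ - p <= q) by nra.
assert (q ^ 2 <= p ^ 2) by nra.
(* [0.45 < 0.95^2 / 2]; then [4 * p^2 >= 1.8 * w > w^2], since [w <= 1.05^2]. *)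
assert (0.45 * w N <= p ^ 2) by lra.
nra.
Qed.

(** * Normal forms of the objective and constraints, and conclusion *)

Lemma opf_objective_isoquad (N : network) (hN : standing_assumptions N)
  (x : R * R) :
  opf_objective N x = isoquad (- c2 N * g N / w N) ((Defs.c1 N + c2 N) * g N)
    ((Defs.c1 N - c2 N) * b N) (- Defs.c1 N * g N * w N) x.
Proof.
pose proof (w_bounds N hN).
destruct x as [p q]; unfold opf_objective, p12, p21, isoquad; simpl fst; simpl snd.
field; lra.
Qed.

(** In complex form, [p21 + i q21 = (g - i b) conj(z) (z - w) / w]. *)
Lemma opf_thermal21 (N : network) (hN : standing_assumptions N)
  (x : R * R) :
  opf_constraint N thermal21 x = thermal ((g N ^ 2 + b N ^ 2) / w N ^ 2) (w N) (su N) x.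
Proof.
pose proof (w_bounds N hN).
destruct x as [p q]; unfold opf_constraint, p21, q21, thermal; simpl fst; simpl snd.
field; lra.
Qed.

Lemma opf_local_maximizer (N : network) (hN : standing_assumptions N)
  (i : opf_index) (x : R * R) :
  feasible (opf_constraint N) x ->
  is_KKT_point_ge (opf_objective N) (opf_constraint N i) x ->
  is_local_maximizer (opf_objective N) (feasible (opf_constraint N)) x.
Proof.
intros Fx HK.
pose proof (w_bounds N hN) as Hw.
pose proof hN as H; unfold standing_assumptions in H.
assert (Hiw : 0 < / w N) by (apply Rinv_0_lt_compat; lra).
assert (Hcg : 0 <= c2 N * g N) by nra.
assert (Hfa : - c2 N * g N / w N <= 0) by (unfold Rdiv; nra).
assert (Hmax : is_local_maximizer (isoquad (- c2 N * g N / w N) ((Defs.c1 N + c2 N) * g N)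
    ((Defs.c1 N - c2 N) * b N) (- Defs.c1 N * g N * w N)) (feasible (opf_constraint N)) x).
{ assert (Q : forall a l m n, (forall y, opf_constraint N i y = isoquad a l m n y) ->
    (0 <= a \/ l + w N * a <= 0) ->
    is_local_maximizer (isoquad (- c2 N * g N / w N) ((Defs.c1 N + c2 N) * g N)
      ((Defs.c1 N - c2 N) * b N) (- Defs.c1 N * g N * w N)) (feasible (opf_constraint N)) x).
  { intros a l m n E Ha.
    apply local_maximizer_isoquad with a l m n (w N); trivial.
    - intros y Fy; rewrite <- E; apply Fy.
    - apply (is_KKT_point_ge_ext _ _ _ _ _ (opf_objective_isoquad N hN) E HK).
    - replace (_ + _) with (Defs.c1 N * g N) by (field; lra); nra.
    - apply (feasible_wR N hN x Fx). }
  destruct i;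
    (* Here [p12^2 + q12^2 = (g^2 + b^2) |z - w|^2], so this limit is only quadratic. *)
    [ apply (Q (g N ^ 2 + b N ^ 2) (- 2 * w N * (g N ^ 2 + b N ^ 2)) 0
               (w N ^ 2 * (g N ^ 2 + b N ^ 2) - su N))
    |
    | apply (Q 0 (g N) (b N) (pg1l N - pd1 N - g N * w N))
    | apply (Q 0 (- g N) (- b N) (g N * w N - (pg1u N - pd1 N)))
    | apply (Q 0 (- b N) (g N) (qg1l N - qd1 N + b N * w N))
    | apply (Q 0 (b N) (- g N) (- b N * w N - (qg1u N - qd1 N)))
    | apply (Q (- g N / w N) (g N) (- b N) (pg2l N - pd2 N))
    | apply (Q (g N / w N) (- g N) (b N) (- (pg2u N - pd2 N)))
    | apply (Q (b N / w N) (- b N) (- g N) (qg2l N - qd2 N))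
    | apply (Q (- b N / w N) (b N) (g N) (- (qg2u N - qd2 N)))
    | apply (Q (- / w N) 0 0 (v2l N ^ 2))
    | apply (Q (/ w N) 0 0 (- v2u N ^ 2))
    | apply (Q 0 (tan (thl N)) (-1) 0)
    | apply (Q 0 (- tan (thu N)) 1 0) ].
  all: try (intros [p q]; unfold opf_constraint, p12, q12, p21, q21, isoquad;
            simpl fst; simpl snd; field; lra).
  2: { apply local_maximizer_thermal with ((g N ^ 2 + b N ^ 2) / w N ^ 2) (w N) (su N);
       trivial.
       - intros y Fy; rewrite <- (opf_thermal21 N hN); apply Fy.
       - apply (is_KKT_point_ge_ext _ _ _ _ _ (opf_objective_isoquad N hN)
                  (opf_thermal21 N hN) HK).
       - apply Rle_mult_inv_pos; nra.
       (* [3 * 0.95^2 * w > 2 * w^2], because [w <= 1.05^2]. *)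
       - pose proof (feasible_modulus N hN x Fx); nra. }
  (* Only [p21_lower], [q21_lower] and [voltage_lower] have [a < 0]; there [l + w * a] is [0], [0]
     and [-1]. *)
  all: first [ left; unfold Rdiv; nra | right; apply Req_le; field; lra
             | right; nra ]. }
destruct Hmax as [_ Hmax].
split; [exact Fx |].
revert Hmax; apply filter_imp; intros y Hy Fy.
rewrite !(opf_objective_isoquad N hN); auto.
Qed.

Theorem corollary1 (N : network) (hN : standing_assumptions N) :
  boundary_invex (opf_objective N) (opf_constraint N).
Proof.
intros i _ x HK.
destruct (classic (feasible (opf_constraint N) x)) as [Fx | nFx].
- right; right; exact (opf_local_maximizer N hN i x Fx HK).
- left; exact nFx.
Qed.
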